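(* Let $\mathcal S$ be a separable metric space equipped with a reference measure (integration written $ds$), $t_{\mathfrak s}:\mathcal S\times\mathcal S\to\mathbb R^{\ge0}$ a transition density, and $\Upsilon\subset\mathcal S$ a bounded measurable set such that $t_{\mathfrak s}(\cdot|s)$ restricted to $\Upsilon$ is bounded and measurable for each $s\in\Upsilon$. Let $\pi_0$ be a probability density, $\Lambda_0\subset\Upsilon$, and $\mu_0=\mathds 1_{\Lambda_0}\pi_0$ (restricted to $\Upsilon$, assumed bounded), and define $\mu_{t+1}(\bar s)=\int_\Upsilon t_{\mathfrak s}(\bar s|s)\mu_t(s)\,ds$ for $\bar s\in\Upsilon$, i.e. $\mu_t=\mathcal R_\Upsilon^t(\mu_0)$ where $\mathcal R_\Upsilon(f)(\bar s)=\int_\Upsilon t_{\mathfrak s}(\bar s|s)f(s)\,ds$ on $\mathbb B(\Upsilon)$. Let $\Psi=\mathrm{span}\{\phi_1,\dots,\phi_h\}\subset\mathbb B(\Upsilon)$ and let $\Pi_\Upsilon:\mathbb B(\Upsilon)\to\Psi$ be a linear projection operator such that $\|\Pi_\Upsilon(t_{\mathfrak s}(\cdot|s))-t_{\mathfrak s}(\cdot|s)\|_\infty\le\mathcal E^{\mathfrak h}$ for all $s\in\Upsilon$, and such that for some finite constant $M^{\mathfrak h}_{\mathfrak f}$, $\int_\Upsilon|\Pi_\Upsilon(t_{\mathfrak s}(\cdot|s))(\bar s)|\,ds\le M^{\mathfrak h}_{\mathfrak f}$ for all $\bar s\in\Upsilon$. Define $\psi^{\mathfrak h}_t=(\Pi_\Upsilon\mathcal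 R_\Upsilon)^t(\mu_0)$ for $t\in\{0,\dots,N\}$. Then $\|\mu_t-\psi_t^{\mathfrak h}\|_\infty\le E_t^{\mathfrak h}$ for all $t\in\{1,\dots,N\}$, where $E^{\mathfrak h}_0=0$ and $E^{\mathfrak h}_{t+1}=M^{\mathfrak h}_{\mathfrak f}E^{\mathfrak h}_t+\mathcal E^{\mathfrak h}$.
   Context: $\mathbb B(\Upsilon)$ is the space of bounded measurable functions $\Upsilon\to\mathbb R$ with norm $\|f\|_\infty=\sup_{s\in\Upsilon}|f(s)|$. $\Pi_\Upsilon(t_{\mathfrak s}(\cdot|s))$ denotes $\Pi_\Upsilon$ applied to the function $\bar s\mapsto t_{\mathfrak s}(\bar s|s)$ on $\Upsilon$. $\mathds 1_A$ is the indicator of $A$; $N\in\mathbb N$ is a fixed horizon.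
   Formalization: Π_Υ is also assumed continuous along uniformly bounded pointwise convergent sequences (the claim fails for general linear projections); the reference measure is taken σ-finite, t_s jointly measurable, and R_Υ is assumed to be well defined from B(Υ) to B(Υ). *)

(* Defs.v *)
From HB Require Import structures.
From mathcomp Require Import all_boot all_order all_algebra.
From mathcomp Require Import all_classical all_reals all_analysis.
Import Order.TTheory GRing.Theory Num.Theory.
Import numFieldNormedType.Exports.

Set Implicit Arguments.
Unset Strict Implicit.
Unset Printing Implicit Defensive.

Local Open Scope classical_set_scope.
Local Open Scope ring_scope.

(* Types with both a metric and a sigma-algebra. The structure does not relate
   the two; [borel_space] says that the sigma-algebra is the Borel one. *)
#[short(type="measurableMetricType")]
HB.structure Definition MeasurableMetric (d : measure_display)
  (K : numDomainType) := {T of Measurable d T & Metric K T}.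

Definition borel_space d (R : realType) (S : measurableMetricType d R) : Prop :=
  (@measurable d S : set (set S)) = <<s @open S >>.

Definition separable (S : topologicalType) : Prop :=
  exists A : set S, countable A /\ dense A.

Definition metric_bounded (R : realType) (S : metricType R) (A : set S) : Prop :=
  exists x r, A `<=` ball x r.

(* Extended-valued, so that an unbounded function has norm +oo; the supremum
   over an empty Y is -oo. *)
Definition supnorm (R : realType) (S : Type) (Y : set S) (f : S -> R) : \bar R :=
  ereal_sup [set `|f s|%:E | s in Y].

Section operators.
Context d (R : realType) (S : measurableType d).
Implicit Types (Y : set S) (f g : S -> R) (P : (S -> R) -> S -> R)
  (t : S -> S -> R) (m : {measure set S -> \bar R}).

(* The space B(Y) of bounded measurable functions Y -> R. Such a function is
   represented by its extension by 0 to S, so that equality in B(Y) is equality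
   of functions; the extension of the restriction of f to Y is [f \_ Y]. *)
Definition bmeas Y : set (S -> R) :=
  [set f | [/\ measurable_fun Y f, (supnorm Y f < +oo)%E
             & forall s, ~ Y s -> f s = 0]].

Definition prob_density m f : Prop :=
  [/\ measurable_fun setT f, forall s, 0 <= f s
    & (\int[m]_s (f s)%:E = 1)%E].

(* [t s' s] stands for t(s'|s). *)
Definition transition_density m t : Prop :=
  [/\ measurable_fun setT (fun p : S * S => t p.1 p.2),
      forall s' s, 0 <= t s' s
    & forall s, (\int[m]_s' (t s' s)%:E = 1)%E].

Definition trans_op m t Y f : S -> R :=
  (fun s' => \int[m]_(s in Y) (t s' s * f s)) \_ Y.

(* The Lebesgue integrals defining [trans_op m t Y] exist on B(Y), and
   [trans_op m t Y] maps B(Y) to itself. *)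
Definition trans_op_wf m t Y : Prop := forall f, bmeas Y f ->
  (forall s', Y s' -> m.-integrable Y (fun s => (t s' s * f s)%:E)) /\
  bmeas Y (trans_op m t Y f).

Definition fspan h (phi : 'I_h -> S -> R) : set (S -> R) :=
  [set f | exists c : 'I_h -> R, f = fun s => \sum_(i < h) c i * phi i s].

Definition linear_projection Y (Psi : set (S -> R)) P : Prop :=
  [/\ forall f, bmeas Y f -> Psi (P f),
      forall (a : R) f g, bmeas Y f -> bmeas Y g ->
        P (fun s => a * f s + g s) = (fun s => a * P f s + P g s)
    & forall f, bmeas Y f -> P (P f) = P f].

(* Continuity of an operator on B(Y) along uniformly bounded pointwise
   convergent sequences. It amounts to f |-> P f s' being integration against
   a finite signed measure for every s' in Y, and it is what allows P to be
   exchanged with the integral in [trans_op]. Linearity and boundedness of P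
   are not enough for that: integration against a purely finitely additive
   set function is bounded and linear, and it need not satisfy Fubini's theorem
   against m. *)
Definition bp_continuous Y P : Prop :=
  forall (u : nat -> S -> R) f (C : R),
    (forall n, bmeas Y (u n)) -> bmeas Y f ->
    (forall n s, Y s -> `|u n s| <= C) ->
    (forall s, Y s -> u n s @[n --> \oo] --> f s) ->
    forall s, Y s -> P (u n) s @[n --> \oo] --> P f s.

End operators.

Fixpoint err (R : realType) (M E : R) (n : nat) : R :=
  if n is k.+1 then M * err M E k + E else 0.

(* Main.v *)
(** Write R for [trans_op m t Y] and t_s for the restriction of t(.|s) to Y.
    For s' in Y the functional f |-> P f s' is linear and continuous along
    bounded pointwise convergent sequences, so A |-> P 1_A s' is a finite signed
    measure, and by its Jordan decomposition P f s' is the difference of the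
    integrals of f against two finite measures. Fubini's theorem then gives
    P (R f) s' = \int_Y P t_s s' f(s) ds. Hence |P (R f) s'| <= M |f|_oo, and
    |R f s' - P (R f) s'| <= E \int f for f >= 0. As the mass of mu_n is at most 1,
    splitting mu_(n+1) - psi_(n+1) into (R - P R) mu_n and P R (mu_n - psi_n)
    yields the recursion for the error. *)
Require Import Defs.
From HB Require Import structures.
From mathcomp Require Import all_boot all_order all_algebra.
From mathcomp Require Import all_classical all_reals all_analysis.
From mathcomp Require Import measurable_realfun.
Import Order.TTheory GRing.Theory Num.Theory.
Import numFieldNormedType.Exports.
From mathcomp Require Import ring.
Import HBNNSimple.
Local Open Scope classical_set_scope.
Local Open Scope ring_scope.

Set Implicit Arguments.
Unset Strict Implicit.
Unset Printing Implicit Defensive.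

(** * Bounded measurable functions on [Y], extended by 0 *)

Lemma supnorm_leP (R : realType) (S : Type) (Y : set S) (f : S -> R) (C : R) :
  (supnorm Y f <= C%:E)%E <-> forall s, Y s -> `|f s| <= C.
Proof.
split=> [fC s Ys|fC]; last first.
  by apply: ge_ereal_sup => _ [s Ys <-]; rewrite lee_fin; exact: fC.
rewrite -lee_fin (le_trans _ fC)//.
by apply: ereal_sup_ubound; exists s.
Qed.

Section bounded_measurable.
Context d (R : realType) (S : measurableType d) (Y : set S).
Hypothesis mY : measurable Y.
Implicit Types f g : S -> R.

(** Vanishing off [Y] turns measurability and boundedness on [Y] into global properties, so later
    arguments can work over all of [S]. *)
Lemma bmeasP f : bmeas Y f <-> [/\ measurable_fun setT f,
  exists2 C, 0 <= C & forall s, `|f s| <= C & forall s, ~ Y s -> f s = 0].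
Proof.
split=> -[mf bf f0].
- have fE : f \_ Y = f.
    by apply/funext => s; rewrite patchE; case: ifPn => // /negP; rewrite inE => /f0.
  split=> //; first by rewrite -fE; apply/(measurable_restrictT _ mY).
  have [C fC] : exists C : R, (supnorm Y f <= C%:E)%E.
    case: (supnorm Y f) bf => [r _|//|_]; first by exists r.
    by exists 0; rewrite leNye.
  (* For empty [Y] the norm is -oo and [C] may be negative; the maximum with 0 repairs this. *)
  exists (Num.max 0 C); first by rewrite le_max lexx.
  move=> s; have [Ys|/f0->] := pselect (Y s); last by rewrite normr0 le_max lexx.
  by rewrite le_max ((supnorm_leP _ _ _).1 fC)// orbT.
- case: bf => C C0 fC; split=> //; first exact: measurable_funTS.
  by apply: (@le_lt_trans _ _ C%:E); rewrite ?ltry//; apply/supnorm_leP.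
Qed.

Lemma bmeas_measurable {f} : bmeas Y f -> measurable_fun setT f.
Proof. by case/bmeasP. Qed.

Lemma bmeas_bounded {f} : bmeas Y f -> exists2 C, 0 <= C & forall s, `|f s| <= C.
Proof. by case/bmeasP. Qed.

Lemma bmeas_out {f} : bmeas Y f -> forall s, ~ Y s -> f s = 0.
Proof. by case/bmeasP. Qed.

Lemma bmeas0 : bmeas Y (fun=> 0 : R).
Proof.
by apply/bmeasP; split=> //; exists 0 => // s; rewrite normr0.
Qed.

Lemma bmeas_lin (a : R) f g :
  bmeas Y f -> bmeas Y g -> bmeas Y (fun s => a * f s + g s).
Proof.
move=> /bmeasP[mf [Cf Cf0 fC] f0] /bmeasP[mg [Cg Cg0 gC] g0]; apply/bmeasP; split.
- by apply: measurable_funD => //; exact: measurable_funM.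
- exists (`|a| * Cf + Cg); first by rewrite addr_ge0// mulr_ge0.
  move=> s; rewrite (le_trans (ler_normD _ _))// lerD// normrM.
  by rewrite ler_wpM2l.
- by move=> s /[dup] /f0-> /g0->; rewrite mulr0 addr0.
Qed.

Lemma bmeas_scale (a : R) f : bmeas Y f -> bmeas Y (fun s => a * f s).
Proof.
move=> bf; have := bmeas_lin a bf bmeas0.
by under eq_fun do rewrite addr0.
Qed.

Lemma bmeas_abs f : bmeas Y f -> bmeas Y (fun s => `|f s|).
Proof.
move=> /bmeasP[mf [C C0 fC] f0]; apply/bmeasP; split.
- exact: measurableT_comp.
- by exists C => // s; rewrite normr_id.
- by move=> s /f0 ->; rewrite normr0.
Qed.

Lemma bmeas_indic (A : set S) : measurable A -> A `<=` Y -> bmeas Y (\1_A : S -> R).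
Proof.
move=> mA AY; apply/bmeasP; split.
- exact: measurable_indic.
- by exists 1 => // s; rewrite indicE; case: (s \in A); rewrite ?normr1 ?normr0.
- by move=> s nYs; rewrite indicE memNset// => /AY.
Qed.

Lemma bmeas_sum (I : Type) (r : seq I) (c : I -> R) (F : I -> S -> R) :
  (forall i, bmeas Y (F i)) -> bmeas Y (fun s => \sum_(i <- r) c i * F i s).
Proof.
move=> bF; elim: r => [|i r IH].
  by under eq_fun do rewrite big_nil; exact: bmeas0.
by under eq_fun do rewrite big_cons; exact: bmeas_lin.
Qed.

Lemma bmeas_integrable (n : {finite_measure set S -> \bar R}) f :
  bmeas Y f -> n.-integrable setT (EFin \o f).
Proof.
move=> /bmeasP[mf [C C0 fC] f0]; apply: measurable_bounded_integrable => //.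
  by rewrite ltey_eq fin_num_measure.
exists C; split; first exact: num_real.
by move=> r Cr s _ /=; rewrite (le_trans (fC s))// ltW.
Qed.

End bounded_measurable.

(** * Linear functionals continuous under bounded pointwise convergence *)

Section functionals.
Context d (R : realType) (S : measurableType d) (Y : set S).
Hypothesis mY : measurable Y.
Implicit Types (f g : S -> R) (L : (S -> R) -> R).

Definition blinear L := forall a f g, bmeas Y f -> bmeas Y g ->
  L (fun s => a * f s + g s) = a * L f + L g.

(** The bound and the convergence are asked on all of [S]; since members of B(Y) vanish off [Y],
    this matches [bp_continuous] at a fixed point. *)
Definition bp_cont L := forall (u : nat -> S -> R) f (C : R),
  (forall n, bmeas Y (u n)) -> bmeas Y f ->
  (forall n s, `|u n s| <= C) -> (forall s, u n s @[n --> \oo] --> f s) ->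
  L (u n) @[n --> \oo] --> L f.

Lemma blinear0 L : blinear L -> L (fun=> 0) = 0.
Proof.
move=> lL; have b0 := bmeas0 R mY; have := lL (-1) _ _ b0 b0.
by rewrite mulr0 addr0 mulN1r addNr.
Qed.

Lemma blinear_sum L (I : Type) (r : seq I) (c : I -> R) (F : I -> S -> R) :
  blinear L -> (forall i, bmeas Y (F i)) ->
  L (fun s => \sum_(i <- r) c i * F i s) = \sum_(i <- r) c i * L (F i).
Proof.
move=> lL bF; elim: r => [|i r IH].
  by under eq_fun do rewrite big_nil; rewrite big_nil blinear0.
under eq_fun do rewrite big_cons.
by rewrite lL ?IH ?big_cons//; exact: bmeas_sum.
Qed.

Lemma blinear_Rintegral (n : {finite_measure set S -> \bar R}) :
  blinear (fun f => \int[n]_x f x).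
Proof.
move=> a f g bf bg; have := bmeas_integrable mY n bf; have := bmeas_integrable mY n bg.
move=> ig iF; rewrite RintegralD//; last first.
  by rewrite [X in integrable _ _ X](_ : _ = (fun x => a%:E * (EFin \o f) x)%E)//;
    exact: integrableZl.
by rewrite RintegralZl.
Qed.

(** Dominated convergence, with the constant [C] as dominating function, integrable because [n] is
    finite. *)
Lemma bp_cont_Rintegral (n : {finite_measure set S -> \bar R}) :
  bp_cont (fun f => \int[n]_x f x).
Proof.
move=> u f C bu bf uC uf; apply: fine_cvg.
have iC : n.-integrable setT (EFin \o cst C).
  exact: finite_measure_integrable_cst.
rewrite fineK; last exact: integrable_fin_num (bmeas_integrable mY n bf).
apply: (dominated_cvg measurableT _ _ _ iC) => //.
- by move=> k; apply/measurable_EFinP; exact: (bmeas_measurable mY (bu k)).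
- by move=> x _; apply: cvg_EFin; [exact: nearW|exact: uf].
- by move=> k x _; rewrite /= lee_fin.
Qed.

(* Simple functions are linear combinations of indicators, and every
   nonnegative function of B(Y) is a bounded pointwise limit of such. *)
Lemma bfunctional_eq0 L : blinear L -> bp_cont L ->
  (forall A, measurable A -> A `<=` Y -> L \1_A = 0) ->
  forall f, bmeas Y f -> L f = 0.
Proof.
move=> lL cL L1.
have Lpos f : bmeas Y f -> (forall s, 0 <= f s) -> L f = 0.
  move=> bf f0; have mf : measurable_fun setT (EFin \o f).
    by apply/measurable_EFinP; exact: (bmeas_measurable mY bf).
  pose g := nnsfun_approx measurableT mf.
  have gf s : g n s @[n --> \oo] --> f s.
    have := @cvg_nnsfun_approx _ _ _ _ measurableT _ mf _ s I.
    move=> /(_ (fun x _ => f0 x)) /fine_cvg.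
    exact.
  have gle n s : g n s <= f s.
    have := @nondecreasing_cvgn_le R (fun n => g n s).
    rewrite (cvg_lim _ (gf s))//; apply => //.
    by move=> a b ab; have /lefP := nd_nnsfun_approx measurableT mf ab; exact.
  have [C C0 fC] := bmeas_bounded mY bf.
  have gC n s : `|g n s| <= C.
    by rewrite ger0_norm// (le_trans (gle n s))// (le_trans (ler_norm _)).
  (* Cutting the level sets down to [Y] puts their indicators in B(Y). It changes nothing: off [Y],
     0 <= [g n] <= [f] = 0, so the only level met there is 0. *)
  have gE n : (g n : S -> R) = fun s =>
      \sum_(y <- finmap.enum_fset (fset_set (range (g n)))) y * \1_((g n @^-1` [set y]) `&` Y) s.
    apply/funext => s; rewrite fimfunE fsbig_finite//=.
    apply: eq_bigr => y _; rewrite !indicE in_setI.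
    have [sY|nsY] := boolP (s \in Y); first by rewrite andbT.
    rewrite andbF; have [|] := boolP (s \in _) => //.
    rewrite inE/= => gy; have : g n s = 0.
      apply/eqP; rewrite eq_le fun_ge0 andbT (le_trans (gle n s))//.
      by rewrite (bmeas_out mY bf)//; rewrite notin_setE in nsY.
    by rewrite gy => ->; rewrite !mul0r.
  have bI n y : bmeas Y (\1_((g n @^-1` [set y]) `&` Y) : S -> R).
    by apply: bmeas_indic => //; apply: measurableI.
  have bg n : bmeas Y (g n) by rewrite gE; exact: bmeas_sum.
  have Lg n : L (g n) = 0.
    rewrite gE blinear_sum// big1// => y _; rewrite L1 ?mulr0//.
    exact: measurableI.
  have := cL _ _ _ bg bf gC gf.
  under eq_cvg do rewrite Lg.
  by move=> /cvg_lim <-//; rewrite lim_cst.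
move=> f bf; have [C C0 fC] := bmeas_bounded mY bf.
(* For signed [f], both C 1_Y + f and C 1_Y are nonnegative, so [L] kills them and hence their
   combination -f. *)
have bY := bmeas_indic R mY mY (@subset_refl _ Y).
have bC : bmeas Y (fun s => C * \1_Y s) by exact: bmeas_scale.
have bCf : bmeas Y (fun s => C * \1_Y s + f s) by exact: bmeas_lin.
have /esym := lL (-1) _ _ bCf bC.
rewrite (Lpos _ bCf); last first.
  move=> s; have [Ys|nYs] := pselect (Y s).
    rewrite indicE mem_set// mulr1 -lerBlDr sub0r (le_trans (ler_norm _))//.
    by rewrite normrN.
  by rewrite indicE memNset// mulr0 (bmeas_out mY bf)// addr0.
rewrite (Lpos _ bC); last by move=> s; rewrite mulr_ge0// indicE.
rewrite mulr0 addr0 => L0.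
have := lL (-1) f _ bf (bmeas0 R mY).
rewrite blinear0// addr0 mulN1r => /esym/eqP.
rewrite eqr_oppLR => /eqP ->; apply/eqP; rewrite oppr_eq0; apply/eqP.
rewrite {}[RHS]L0; congr L; apply/funext => s.
by rewrite !mulN1r opprD addrAC addNr add0r addr0.
Qed.

End functionals.

(** * Representation of functionals by finite measures *)

Section riesz.
Context d (R : realType) (S : measurableType d) (Y : set S).
Hypothesis mY : measurable Y.
Variable L : (S -> R) -> R.
Hypotheses (lL : blinear Y L) (cL : bp_cont Y L).

(** The candidate signed measure. Intersecting with [Y] keeps the indicator in B(Y) for every
    measurable [A]. *)
Let nu (A : set S) : \bar R := (L \1_(A `&` Y))%:E.

Let bI (A : set S) : measurable A -> bmeas Y (\1_(A `&` Y) : S -> R).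
Proof. by move=> mA; apply: (bmeas_indic R mY) => //; exact: measurableI. Qed.

Let nu0 : nu set0 = 0%E.
Proof. by rewrite /nu set0I indic0 (blinear0 mY). Qed.

Let nu_fin A : measurable A -> nu A \is a fin_num.
Proof. by []. Qed.

(** For disjoint sets the partial sums of indicators stay below 1 and converge pointwise to the
    indicator of the union, so continuity of [L] applies. *)
Let nu_sigma_additive : semi_sigma_additive nu.
Proof.
move=> F mF tF mU; pose G i := F i `&` Y.
have tG : trivIset setT G by exact: trivIset_setIr.
have -> : nu (\bigcup_n F n) = (L \1_(\bigcup_n G n))%:E.
  by rewrite /nu setI_bigcupl.
have bG i : bmeas Y (\1_(G i) : S -> R) by exact: bI.
(* The factors 1 give the partial sums the shape required by [blinear_sum]. *)
have sumE s n : (\sum_(0 <= i < n) (\1_(G i) s)%:E)%E =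
    (\sum_(0 <= i < n) 1 * \1_(G i) s)%:E :> \bar R.
  by rewrite sumEFin; congr EFin; apply: eq_bigr => i _; rewrite mul1r.
have -> : (fun n => \sum_(0 <= i < n) nu (F i))%E =
    (fun n => (L (fun s => \sum_(0 <= i < n) 1 * \1_(G i) s))%:E).
  apply/funext => n; rewrite (blinear_sum mY)// sumEFin; congr EFin.
  by apply: eq_bigr => i _; rewrite mul1r.
apply: cvg_EFin; first exact: nearW.
apply: (cL (C := 1)).
- by move=> n; exact: (bmeas_sum mY).
- apply: (bmeas_indic R mY) => //; first by apply: bigcupT_measurable => i; exact: measurableI.
  by move=> s [i _ []].
- move=> n s; rewrite ger0_norm; last first.
    by apply: sumr_ge0 => i _; rewrite mul1r indicE.
  rewrite -lee_fin -sumE.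
  apply: (@le_trans _ _ (\sum_(0 <= i <oo) (\1_(G i) s)%:E)%E).
    by apply: nneseries_lim_ge => i _; rewrite lee_fin indicE.
  by rewrite -indic_bigcup// lee_fin indicE; case: (s \in _).
- move=> s; have : (\sum_(0 <= i < n) (\1_(G i) s)%:E)%E @[n --> \oo] -->
      ((\1_(\bigcup_n G n) s)%:E : \bar R).
    rewrite indic_bigcup//; apply: is_cvg_nneseries => i _ _.
    by rewrite lee_fin indicE.
  by under eq_cvg do rewrite sumE; move=> /fine_cvg.
Qed.

Lemma bp_cont_riesz : exists n1 n2 : {finite_measure set S -> \bar R},
  forall f, bmeas Y f -> L f = \int[n1]_x f x - \int[n2]_x f x.
Proof.
pose c : {charge set S -> \bar R} :=
  HB.pack nu (isCharge.Build _ _ _ nu nu0 nu_fin nu_sigma_additive).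
have [P [N PN]] := Hahn_decomposition c.
pose n1 : {finite_measure set S -> \bar R} := jordan_pos PN.
pose n2 : {finite_measure set S -> \bar R} := jordan_neg PN.
exists n1, n2 => f bf; apply/eqP; rewrite -subr_eq0; apply/eqP.
(* [L] minus its candidate representation is again linear and continuous, so it suffices that it
   vanish on indicators, where it is the Jordan decomposition of [nu]. *)
apply: (@bfunctional_eq0 _ _ _ _ mY
  (fun f => L f - (\int[n1]_x f x - \int[n2]_x f x))) => //.
- move=> a g h bg bh; rewrite lL//.
  rewrite (blinear_Rintegral mY n1 a bg bh) (blinear_Rintegral mY n2 a bg bh).
  by ring.
- move=> u g C bu bg uC ug; apply: cvgB; first exact: (cL (C := C)).
  by apply: cvgB; apply: (bp_cont_Rintegral mY _ (C := C)).
move=> A mA AY; rewrite /Rintegral !integral_indic// setIT.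
have := jordan_decomp PN mA; rewrite /cadd/= cscaleN1 /nu setIidl// => LA.
have f1 : n1 A \is a fin_num by exact: fin_num_measure.
have f2 : n2 A \is a fin_num by exact: fin_num_measure.
rewrite -(fineB f1 f2).
by move/(congr1 fine): LA => /= <-; rewrite subrr.
Qed.

End riesz.

(** * Exchanging functionals with the transition operator *)

Section trans_op_fubini.
Context d (R : realType) (S : measurableType d).
Variables (m : {sigma_finite_measure set S -> \bar R}) (t : S -> S -> R).
Variable Y : set S.
Hypothesis mY : measurable Y.
Hypothesis tm : transition_density m t.
Hypothesis bt : forall s, Y s -> bmeas Y ((t^~ s) \_ Y).
Hypothesis wfR : trans_op_wf m t Y.
Implicit Type f : S -> R.

(** The source state comes first. The extension by 0, together with [f] = 0 off [Y], turns integrals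
    over [Y] into integrals over [S], as Fubini on the full product requires. *)
Let T s := (t^~ s) \_ Y.

Let T_ge0 s s' : 0 <= T s s'.
Proof. by case: tm => _ t0 _; rewrite /T patchE; case: ifPn. Qed.

Let trans_integrable f s' :
  bmeas Y f -> m.-integrable setT (fun s => (T s s' * f s)%:E).
Proof.
move=> bf; have [Ys'|nYs'] := pselect (Y s'); last first.
  rewrite [X in integrable _ _ X](_ : _ = cst 0%E); first exact: integrable0.
  by apply/funext => s; rewrite /T patchE (memNset nYs') mul0r.
have [int_tf _] := wfR bf; have := int_tf _ Ys'.
move=> /(integrable_mkcond _ mY); congr (integrable _ _ _).
apply/funext => s; rewrite patchE /T patchE (mem_set Ys').
by case: ifPn => //; rewrite notin_setE => /(bmeas_out mY bf) fs0; rewrite fs0 mulr0.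
Qed.

(** Integrability makes the passage from extended to real values lossless, so [trans_op] can enter
    Tonelli and Fubini arguments. *)
Let trans_opE f s' : bmeas Y f ->
  (\int[m]_s (T s s' * f s)%:E = (trans_op m t Y f s')%:E)%E.
Proof.
move=> bf; rewrite -[LHS]fineK; last exact: integrable_fin_num (trans_integrable s' bf).
congr EFin; rewrite /trans_op patchE; case: ifPn => [|nYs']; last first.
  rewrite integral0_eq// => s _.
  by rewrite /T patchE (negbTE nYs') mul0r.
rewrite inE => Ys'; rewrite Rintegral_mkcond; apply: eq_Rintegral => s _.
rewrite patchE /T patchE (mem_set Ys').
by case: ifPn => //; rewrite notin_setE => /(bmeas_out mY bf) fs0; rewrite fs0 mulr0.
Qed.

Let measurable_kernel f : bmeas Y f ->
  measurable_fun setT (fun p : S * S => (T p.1 p.2 * f p.1)%:E).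
Proof.
move=> bf; case: tm => mt _ _.
apply/measurable_EFinP; apply: measurable_funM; last first.
  by apply: measurableT_comp => //; exact: (bmeas_measurable mY bf).
rewrite [X in measurable_fun _ X](_ : _ =
    fun p : S * S => t p.2 p.1 * \1_Y p.2); last first.
  by apply/funext => p; rewrite /T patch_indic.
apply: measurable_funM.
  exact: (measurableT_comp mt (@measurable_swap _ _ S S)).
by apply: measurableT_comp => //; exact: measurable_indic.
Qed.

Lemma trans_op_fubini (n : {finite_measure set S -> \bar R}) f : bmeas Y f ->
  m.-integrable setT (fun s => (\int[n]_s' ((t^~ s) \_ Y) s' * f s)%:E) /\
  \int[n]_s' trans_op m t Y f s' =
  \int[m]_s (\int[n]_s' ((t^~ s) \_ Y) s' * f s).
Proof.
move=> bf; pose k (p : S * S) : \bar R := (T p.1 p.2 * f p.1)%:E.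
have mk : measurable_fun setT k by exact: measurable_kernel.
have ik : (m \x n)%E.-integrable setT k.
  (* By Tonelli it is enough to bound one iterated integral of |k|; the inner one is the transition
     operator at |f|, which lies in B(Y) and so is integrable for the finite measure [n]. *)
  apply/(integrable21ltyP m n mk).
  have bRf := (wfR (bmeas_abs mY bf)).2.
  rewrite (eq_integral (fun s' => (trans_op m t Y (fun s => `|f s|) s')%:E)).
    by rewrite ltey_eq (integrable_fin_num _ (bmeas_integrable mY n bRf)).
  move=> s' _; rewrite -trans_opE; last exact: bmeas_abs.
  by apply: eq_integral => s _; rewrite /k/= normrM (ger0_norm (T_ge0 _ _)).
have kE s : (\int[n]_s' k (s, s') = (\int[n]_s' T s s' * f s)%:E)%E.
  (* Boundedness of [T s] is assumed for [s] in [Y] only; elsewhere [f s] = 0. *)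
  have [Ys|nYs] := pselect (Y s); last first.
    by rewrite /k/= (bmeas_out mY bf nYs) mulr0 integral0_eq// => s' _; rewrite mulr0.
  have iT := bmeas_integrable mY n (bt Ys).
  rewrite /k/= -RintegralZr// /Rintegral fineK//; apply: integrable_fin_num => //.
  have := integrableZr measurableT (f s) iT.
  by congr (integrable _ _ _).
split.
  have := integrable_fubini_F ik; congr (integrable _ _ _).
  by apply/funext => s; rewrite /fubini_F kE.
rewrite /Rintegral; congr fine.
under [RHS]eq_integral do rewrite -kE.
rewrite (Fubini ik); apply: eq_integral => s' _.
by rewrite -trans_opE.
Qed.

(** Fubini is applied to each of the two measures representing [L], and the results are subtracted.
    The integrability claim is what later allows such real integrals to be added and compared. *)
Lemma functional_trans_op (L : (S -> R) -> R) f :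
  blinear Y L -> bp_cont Y L -> bmeas Y f ->
  m.-integrable Y (fun s => (L ((t^~ s) \_ Y) * f s)%:E) /\
  L (trans_op m t Y f) = \int[m]_(s in Y) (L ((t^~ s) \_ Y) * f s).
Proof.
move=> lL cL bf.
have [n1 [n2 LE]] := bp_cont_riesz mY lL cL.
have [i1 e1] := trans_op_fubini n1 bf.
have [i2 e2] := trans_op_fubini n2 bf.
have gE : (fun s => L (T s) * f s) \_ Y =
    (fun s => \int[n1]_s' T s s' * f s - \int[n2]_s' T s s' * f s).
  apply/funext => s; rewrite patchE; case: ifPn.
    by rewrite inE => Ys; rewrite LE ?mulrBl//; exact: bt.
  by rewrite notin_setE => /(bmeas_out mY bf) ->; rewrite !mulr0 subrr.
split.
  apply/(integrable_mkcond _ mY).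
  have := integrableB measurableT i1 i2; congr (integrable _ _ _).
  apply/funext => s; have /= := congr1 (@^~ s) gE; rewrite -EFinB => <-.
  by rewrite !patchE; case: ifPn.
rewrite Rintegral_mkcond gE RintegralB// -e1 -e2 LE//.
by case: (wfR bf).
Qed.

Lemma trans_op_ge0 f : (forall s, 0 <= f s) -> forall s', 0 <= trans_op m t Y f s'.
Proof.
move=> f0 s'; rewrite /trans_op patchE; case: ifPn => // _.
by apply: Rintegral_ge0 => s _; rewrite mulr_ge0//; case: tm.
Qed.

(** By Tonelli, integrate in the target first: [t] has total mass 1 over [S], hence at most 1 over
    [Y]. The inequality reflects mass leaving [Y]. *)
Lemma trans_op_mass f : bmeas Y f -> (forall s, 0 <= f s) ->
  (\int[m]_s' (trans_op m t Y f s')%:E <= \int[m]_s (f s)%:E)%E.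
Proof.
move=> bf f0; pose k (p : S * S) : \bar R := (T p.1 p.2 * f p.1)%:E.
have mk : measurable_fun setT k by exact: measurable_kernel.
have k0 p : (0 <= k p)%E by rewrite lee_fin mulr_ge0.
under eq_integral do rewrite -trans_opE//.
rewrite -(fubini_tonelli k)//; apply: ge0_le_integral => //.
- by move=> s _; exact: integral_ge0.
- exact: measurable_fun_fubini_tonelli_F.
- by apply/measurable_EFinP; exact: (bmeas_measurable mY bf).
move=> s _; have [mt t0 t1] := tm.
have mts : measurable_fun setT (fun s' => (t s' s)%:E).
  apply/measurable_EFinP.
  exact: (measurable_fun_pair1 s mt).
rewrite -[leRHS]mule1 -(t1 s) -ge0_integralZl//; last 2 first.
- by move=> s' _; rewrite lee_fin.
- by rewrite lee_fin.
apply: ge0_le_integral => //.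
- exact: (measurable_fun_pair2 s mk).
- exact: measurable_funeM.
move=> s' _; rewrite /k/= -EFinM lee_fin mulrC ler_wpM2l// /T patchE.
by case: ifPn.
Qed.

End trans_op_fubini.

(** * The projection and its point evaluations *)

Section projection.
Context d (R : realType) (S : measurableType d) (Y : set S).
Hypothesis mY : measurable Y.
Variables (h : nat) (phi : 'I_h -> S -> R).
Hypothesis bphi : forall i, bmeas Y (phi i).
Variable P : (S -> R) -> S -> R.
Hypothesis linP : linear_projection Y (fspan phi) P.

Lemma bmeas_projection f : bmeas Y f -> bmeas Y (P f).
Proof. by case: linP => Pspan _ _ /Pspan[c ->]; exact: bmeas_sum. Qed.

Lemma blinear_projection s : blinear Y (fun f => P f s).
Proof. by case: linP => _ PD _ a f g bf bg; rewrite PD. Qed.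

Lemma bp_cont_projection s : bp_continuous Y P -> Y s -> bp_cont Y (fun f => P f s).
Proof. by move=> cP Ys u f C bu bf uC uf; exact: (cP u f C). Qed.

End projection.

(** * One-step error estimates *)

Section error_bounds.
Context d (R : realType) (S : measurableType d).
Variables (m : {sigma_finite_measure set S -> \bar R}) (t : S -> S -> R).
Variable Y : set S.
Hypothesis mY : measurable Y.
Hypothesis tm : transition_density m t.
Hypothesis bt : forall s, Y s -> bmeas Y ((t^~ s) \_ Y).
Hypothesis wfR : trans_op_wf m t Y.
Variables (h : nat) (phi : 'I_h -> S -> R) (P : (S -> R) -> S -> R).
Hypothesis linP : linear_projection Y (fspan phi) P.
Hypothesis cP : bp_continuous Y P.
Implicit Type f : S -> R.

Let projection_trans_op s' f (Ys' : Y s') (bf : bmeas Y f) :=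
  functional_trans_op mY tm bt wfR (blinear_projection linP s')
    (bp_cont_projection cP Ys') bf.

(** This is the integrability part of [functional_trans_op] at the indicator of [Y]. *)
Let integrable_projection s' : Y s' ->
  m.-integrable Y (EFin \o (fun s => P ((t^~ s) \_ Y) s')).
Proof.
move=> Ys'.
have := (projection_trans_op Ys' (bmeas_indic R mY mY (@subset_refl _ Y))).1.
apply: eq_integrable => // s; rewrite inE => Ys.
by rewrite indicE mem_set// mulr1.
Qed.

(** Stability: the value is the integral of [f] against the kernel P t_s(s'), whose absolute
    integral over [s] is at most [M]. *)
Lemma projection_trans_op_le M e f s' :
  (\int[m]_(s in Y) (`|P ((t^~ s) \_ Y) s'|)%:E <= M%:E)%E ->
  bmeas Y f -> (forall s, Y s -> `|f s| <= e) -> Y s' ->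
  `|P (trans_op m t Y f) s'| <= M * e.
Proof.
move=> PM bf fe Ys'; have [iPf ->] := projection_trans_op Ys' bf.
have e0 : 0 <= e := le_trans (normr_ge0 _) (fe _ Ys').
have iP : m.-integrable Y (EFin \o (fun s => `|P ((t^~ s) \_ Y) s'|)).
  exact: integrable_norm (integrable_projection Ys').
rewrite (le_trans (le_normr_Rintegral mY iPf))//.
apply: (@le_trans _ _ (\int[m]_(s in Y) (`|P ((t^~ s) \_ Y) s'| * e))).
  apply: le_Rintegral => //.
  - exact: integrable_norm.
  - by have := integrableZr mY e iP; congr (integrable _ _ _).
  - by move=> s Ys; rewrite normrM ler_wpM2l// fe.
rewrite RintegralZr// ler_wpM2r// -lee_fin /Rintegral fineK//.
by have := integrable_fin_num mY iP.
Qed.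

(** Consistency: the difference is the integral of [f] against t_s(s') - P t_s(s'), bounded by [E].
    As [f] is a weight of mass at most 1, neither its supremum nor the measure of [Y] enters. *)
Lemma trans_op_sub_projection_le E f s' :
  (forall s, Y s -> `|P ((t^~ s) \_ Y) s' - ((t^~ s) \_ Y) s'| <= E) ->
  bmeas Y f -> (forall s, 0 <= f s) -> (\int[m]_s (f s)%:E <= 1)%E -> Y s' ->
  `|trans_op m t Y f s' - P (trans_op m t Y f) s'| <= E.
Proof.
move=> PE bf f0 f1 Ys'; have [iPf ->] := projection_trans_op Ys' bf.
have E0 : 0 <= E by exact: le_trans (PE _ Ys').
have itf := (wfR bf).1 _ Ys'.
have fi : m.-integrable setT (EFin \o f).
  apply/integrableP; split.
    by apply/measurable_EFinP; exact: (bmeas_measurable mY bf).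
  under eq_integral do rewrite /= ger0_norm//.
  by rewrite (le_lt_trans f1)// ltry.
have fiY : m.-integrable Y (EFin \o f) by exact: integrableS fi.
rewrite /trans_op patchE mem_set// -RintegralB//.
have iB : m.-integrable Y
    (EFin \o (fun s => t s' s * f s - P ((t^~ s) \_ Y) s' * f s)).
  by have := integrableB mY itf iPf; congr (integrable _ _ _).
rewrite (le_trans (le_normr_Rintegral mY iB))//.
apply: (@le_trans _ _ (\int[m]_(s in Y) (E * f s))).
  apply: le_Rintegral => //.
  - exact: integrable_norm.
  - by have := integrableZl mY E fiY; congr (integrable _ _ _).
  - move=> s Ys; rewrite -mulrBl normrM (ger0_norm (f0 s)) ler_wpM2r//.
    by have := PE _ Ys; rewrite distrC patchE mem_set.
(* It remains to see that the mass of [f] on [Y] is at most its mass on [S], hence at most 1. *)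
rewrite RintegralZl// ler_piMr// -lee_fin /Rintegral fineK.
  rewrite (le_trans _ f1)//; apply: ge0_subset_integral => //.
    exact: (measurable_int _ fi).
  by move=> s _; rewrite lee_fin.
by have := integrable_fin_num mY fiY.
Qed.

Lemma projected_error_step M E f g e s' :
  (\int[m]_(s in Y) (`|P ((t^~ s) \_ Y) s'|)%:E <= M%:E)%E ->
  (forall s, Y s -> `|P ((t^~ s) \_ Y) s' - ((t^~ s) \_ Y) s'| <= E) ->
  bmeas Y f -> bmeas Y g -> (forall s, 0 <= f s) ->
  (\int[m]_s (f s)%:E <= 1)%E -> (forall s, Y s -> `|f s - g s| <= e) -> Y s' ->
  `|trans_op m t Y f s' - P (trans_op m t Y g) s'| <= M * e + E.
Proof.
move=> PM PE bf bg f0 f1 fge Ys'.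
have bd : bmeas Y (fun s => -1 * g s + f s) by exact: bmeas_lin.
(* Additivity is read off the integral formula for the composite of [P] and [trans_op], applied to
   all three functions. *)
have dE : P (trans_op m t Y (fun s => -1 * g s + f s)) s' =
    P (trans_op m t Y f) s' - P (trans_op m t Y g) s'.
  have [_ ->] := projection_trans_op Ys' bd.
  have [ifP ->] := projection_trans_op Ys' bf.
  have [igP ->] := projection_trans_op Ys' bg.
  rewrite -RintegralB//; apply: eq_Rintegral => s _.
  by rewrite mulN1r addrC mulrBr.
rewrite -(subrKA (P (trans_op m t Y f) s')) (le_trans (ler_normD _ _))// addrC.
apply: lerD; last exact: trans_op_sub_projection_le.
rewrite -dE; apply: projection_trans_op_le => // s Ys.
by rewrite mulN1r addrC fge.
Qed.

End error_bounds.

(** * Induction on the horizon *)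

Theorem theorem5p1 (R : realType) (d : measure_display)
  (S : measurableMetricType d R)
  (hS : separable S) (hBorel : borel_space S)
  (m : {sigma_finite_measure set S -> \bar R})
  (t : S -> S -> R) (ht : transition_density m t)
  (Y : set S) (hYm : measurable Y) (hYb : metric_bounded Y)
  (htY : forall s, Y s -> bmeas Y ((t^~ s) \_ Y))
  (hR : trans_op_wf m t Y)
  (pi0 : S -> R) (hpi0 : prob_density m pi0)
  (Lambda0 : set S) (hLY : Lambda0 `<=` Y)
  (mu0 : S -> R) (hmu0 : mu0 = (fun s => \1_Lambda0 s * pi0 s))
  (hmu0B : bmeas Y mu0)
  (h : nat) (phi : 'I_h -> S -> R) (hphi : forall i, bmeas Y (phi i))
  (P : (S -> R) -> S -> R)
  (hP : linear_projection Y (fspan phi) P) (hPc : bp_continuous Y P)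
  (E M : R)
  (hE : forall s, Y s ->
    (supnorm Y (fun s' => (P ((t^~ s) \_ Y) s' - ((t^~ s) \_ Y) s')%R)
      <= E%:E)%E)
  (hM : forall s', Y s' ->
    (\int[m]_(s in Y) (`|P ((t^~ s) \_ Y) s'|)%:E <= M%:E)%E)
  (N : nat) (mu psi : nat -> S -> R)
  (hmu : forall n, mu n = iter n (trans_op m t Y) mu0)
  (hpsi : forall n, (n <= N)%N ->
    psi n = iter n (fun f => P (trans_op m t Y f)) mu0) :
  forall n, (1 <= n <= N)%N ->
    (supnorm Y (fun s => (mu n s - psi n s)%R) <= (err M E n)%:E)%E.
Proof.
have [_ pi0_ge0 pi0_int] := hpi0.
(* The mass starts at most 1 because [mu0] <= [pi0]. Only [mu] carries this bound and a sign, which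
   is why the consistency error is taken at [mu n] and the stability bound at [mu n] - [psi n]. *)
have mass n : [/\ bmeas Y (mu n), forall s, 0 <= mu n s
    & (\int[m]_s (mu n s)%:E <= 1)%E].
  elim: n => [|n [bmu mu_ge0 mu_le1]].
    have mu0E s : mu0 s = \1_Lambda0 s * pi0 s by rewrite hmu0.
    rewrite hmu /=; split=> // [s|]; first by rewrite mu0E mulr_ge0.
    rewrite -pi0_int; apply: ge0_le_integral => //.
    - by move=> s _; rewrite lee_fin mu0E mulr_ge0.
    - by apply/measurable_EFinP; exact: (bmeas_measurable hYm hmu0B).
    - by apply/measurable_EFinP; case: hpi0.
    - by move=> s _; rewrite lee_fin mu0E ler_piMl// indicE.
  have -> : mu n.+1 = trans_op m t Y (mu n) by rewrite !hmu.
  split; first by case: (hR _ bmu).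
  - exact: (trans_op_ge0 _ ht).
  - by rewrite (le_trans _ mu_le1)// (trans_op_mass hYm ht hR).
(* The induction starts at 0, where both sequences equal [mu0] and [err] is 0. Membership of [psi n]
   in B(Y) is carried along because the one-step bound requires it. *)
have err_le n : (n <= N)%N -> bmeas Y (psi n) /\
    forall s, Y s -> `|mu n s - psi n s| <= err M E n.
  elim: n => [_|n IH nN].
    rewrite hpsi// hmu; split=> // s _.
    by rewrite subrr normr0.
  have [bpsi err_n] := IH (ltnW nN); have [bmu mu_ge0 mu_le1] := mass n.
  have -> : mu n.+1 = trans_op m t Y (mu n) by rewrite !hmu.
  have -> : psi n.+1 = P (trans_op m t Y (psi n)).
    by rewrite !hpsi// ltnW.
  split.
    by apply: (bmeas_projection hYm hphi hP); case: (hR _ bpsi).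
  move=> s' Ys' /=.
  apply: (projected_error_step hYm ht htY hR hP hPc) => //; first exact: hM.
  by move=> s Ys; have /supnorm_leP := hE _ Ys; exact.
move=> n /andP[_ nN]; apply/supnorm_leP.
by case: (err_le n nN).
Qed.
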